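(* Consider the optimal transport linear program described in the context, and let the sequences $\{x^k\}$ and $\{\mathcal{I}_k\}$ be generated by the random block coordinate descent - submatrix and diagonal band algorithm (described in the context) with submatrix row/column dimension $m<n$, band width $p\in[3,n]$ and selection parameter $s\in[0,1]$. Then they satisfy the expected Gauss-Southwell-q rule $$\mathbb{E}[q(x^k;\mathcal{I}_k)\mid\mathcal{F}_k]\le v\,q(x^k;\mathcal{N}),$$ with $v\ge\frac{s\,n(p-2)}{(n^2-3)(n!)^2}$. Therefore, for an optimal solution $x^*$, $c^T(x^k-x^* )\to0$ almost surely and $\mathbb{E}[c^T(x^k-x^* )]$ converges to $0$ exponentially with rate $1-v$, i.e. $\mathbb{E}[c^T(x^k-x^* )]\le(1-v)^k\,\mathbb{E}[c^T(x^0-x^* )]$.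
   Context: For $X\in\mathbb{R}^{n\times n}$, $\operatorname{vec}(X)=(X(1,1),\dots,X(n,1),X(1,2),\dots,X(n,2),\dots,X(1,n),\dots,X(n,n))^T\in\mathbb{R}^{n^2}$; $\operatorname{supp}$ of a vector is the set of indices of its nonzero entries. Let $N=n^2$, $\mathcal{N}=\{1,\dots,N\}$, and let $A\in\mathbb{R}^{2n\times n^2}$ be $$A=\begin{pmatrix} I_n & I_n & \cdots & I_n\\ \mathbf 1_n^T & & & \\ & \mathbf 1_n^T & & \\ & & \ddots & \\ & & & \mathbf 1_n^T\end{pmatrix}\quad(n\text{ column blocks}),$$ where $I_n$ is the $n\times n$ identity and $\mathbf 1_n\in\mathbb{R}^n$ the all-ones vector. Let $b=((r^1)^T,(r^2)^T)^T$ with $r^1,r^2\in\mathbb{R}^n_+$, and $c=\operatorname{vec}(C)$ with $C\in\mathbb{R}^{n\times n}$ a cost matrix. The optimal transport linear program is $\min c^Tx$ subject to $Ax=b$, $x\ge0$; it is assumed to be finite and to have an optimal solution. Let $\mathcal{X}=\{x\in\mathbb{R}^N: Ax=b,\ x\ge0\}$. For $x\in\mathcal{X}$ and $\mathcal{I}\subseteq\mathcal{N}$, let $\mathcal{D}(x;\mathcal{I})$ and $q(x;\mathcal{I})$ denote respectively the set of optimal solutions and the optimal value of $$\min_{d\in\mathbb{R}^N}\{c^Td : x+d\ge 0,\ Ad=0,\ d_i=0\ \ \forall i\in\mathcal{N}\setminus\mathcal{I}\}.$$ In the expected Gauss-Southwell-q rule, $v\in(0,1]$ is a constant and $\mathcal{F}_k=\{x^0,\dots,x^k\}$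 denotes the history of the algorithm. Diagonal band selection with integer width $p$, $3\le p\le n$: let $G\in\mathbb{R}^{n\times n}$ have $G(i,j)=1$ if either $j\in[1,n-p+1]$ and $i\in[j,j+p-1]$, or $j\in[n-p+2,n]$ and $i\in[1,j+p-n-1]\cup[j,n]$ (integer intervals), and $G(i,j)=0$ otherwise. Obtain $\bar D^k$ by uniformly randomly permuting all columns and rows of $G$, and set $\mathcal{I}_k=\operatorname{supp}(\operatorname{vec}(\bar D^k))$. Submatrix selection with size $m<n$: uniformly randomly pick two sets of $m$ different numbers $i_1,\dots,i_m$ and $j_1,\dots,j_m$ out of $\{1,\dots,n\}$, let $\bar D^k(i,j)=1$ if $i\in\{i_1,\dots,i_m\}$ and $j\in\{j_1,\dots,j_m\}$ and $\bar D^k(i,j)=0$ otherwise, and set $\mathcal{I}_k=\operatorname{supp}(\operatorname{vec}(\bar D^k))$. Random block coordinate descent - submatrix and diagonal band: choose a feasible $X^0\in\mathbb{R}^{n\times n}$, the dimension $m$, the band width $p\in[3,n]$ and the selection parameter $s\in[0,1]$, and let $x^0=\operatorname{vec}(X^0)\in\mathcal{X}$. At each iteration $k=0,1,2,\dots$ (with random choices drawn afresh): (1) with probability $s$ choose $\mathcal{I}_k$ by the diagonal band selection; otherwise choose $\mathcal{I}_k$ by the submatrix selection; (2) find $d^k\in\mathcal{D}(x^k;\mathcal{I}_k)$; (3) set $x^{k+1}=x^k+d^k$.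
   Formalization: For s = 0 the claim fails (with m = 1 the iterates never move), so v > 0 and the convergence of the gap to 0 (almost surely and in expectation) are asserted only for s > 0; for s = 0 only v in [0,1], the rule, the lower bound and the (1-v)^k estimate are stated. *)

(* Defs.v *)
From HB Require Import structures.
From mathcomp Require Import all_boot all_order all_algebra all_fingroup.
From mathcomp Require Import all_classical all_reals all_analysis.

Set Implicit Arguments.
Unset Strict Implicit.
Unset Printing Implicit Defensive.

Import Order.TTheory GRing.Theory Num.Theory.
Import numFieldNormedType.Exports.

Local Open Scope classical_set_scope.
Local Open Scope ring_scope.

Section Vectorization.
Variables (R : realType) (n : nat).
Implicit Types X : 'M[R]_n.

(* [mxvec] concatenates rows, hence the transposition: [vec X] stacks the
   columns of X. *)
Definition vec X : 'cV[R]_(n * n) := (mxvec X^T)^T.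

Definition supp (N : nat) (x : 'cV[R]_N) : {set 'I_N} :=
  [set i : 'I_N | x i 0 != 0]%SET.

Definition dotp (N : nat) (c x : 'cV[R]_N) : R := (c^T *m x) 0 0.

(* Each row of the constraint matrix consists of n consecutive blocks of
   length n, written here as the rows of an n x n matrix: block j of row i is
   row i of the identity in the upper half, and in the lower half it is the
   all-ones row if j = i and zero otherwise. *)
Definition ot_mx : 'M[R]_(n + n, n * n) :=
  col_mx
    (\matrix_(i < n) mxvec (\matrix_(j < n) row i (1%:M : 'M[R]_n)))
    (\matrix_(i < n) mxvec
       (\matrix_(j < n) (if j == i then const_mx 1 else 0 : 'rV[R]_n))).

Lemma ot_mx_vec X :
  ot_mx *m vec X =
  col_mx (\col_i \sum_(j < n) X i j) (\col_j \sum_(i < n) X i j).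
Proof.
have dotE (Y : 'M[R]_n) : mxvec Y *m vec X =
    (\sum_(j < n) \sum_(l < n) Y j l * X l j)%:M.
  apply/matrixP => a b; rewrite !ord1 !mxE eqxx mulr1n pair_big /=.
  rewrite (reindex _ (curry_mxvec_bij n n)) /=.
  by apply: eq_bigr => -[j i] _ /=; rewrite mxvecE; congr (_ * _); rewrite mxE mxvecE mxE.
have rowE (f : 'I_n -> 'M[R]_n) i :
    ((\matrix_(i < n) mxvec (f i)) *m vec X) i 0 =
    \sum_(j < n) \sum_(l < n) f i j l * X l j.
  have -> (u : 'cV[R]_n) : u i 0 = row i u 0 0 by rewrite mxE.
  by rewrite row_mul rowK dotE mxE eqxx mulr1n.
rewrite mul_col_mx; congr col_mx; apply/colP => i; rewrite rowE mxE.
- apply: eq_bigr => j _; rewrite (bigD1 i) //= !mxE eqxx mul1r big1 ?addr0//.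
  by move=> l /negPf li; rewrite !mxE eq_sym li mul0r.
- rewrite (bigD1 i) //= [X in _ + X]big1 ?addr0.
    by apply: eq_bigr => l _; rewrite !mxE eqxx mxE mul1r.
  by move=> j /negPf ji; rewrite big1// => l _; rewrite !mxE ji mxE mul0r.
Qed.

End Vectorization.

Section OptimalTransport.
Variables (R : realType) (n : nat).

Definition minimizers (U : Type) (f : U -> R) (S : set U) : set U :=
  [set z | S z /\ forall y, S y -> f z <= f y].

Definition ot_feasible (r1 r2 : 'cV[R]_n) : set 'cV[R]_(n * n) :=
  [set x | ot_mx R n *m x = col_mx r1 r2 /\ forall i, 0 <= x i 0].

Definition ot_optimal (C : 'M[R]_n) (r1 r2 : 'cV[R]_n) : set 'cV[R]_(n * n) :=
  minimizers (dotp (vec C)) (ot_feasible r1 r2).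

Definition block_feasible (x : 'cV[R]_(n * n)) (I : {set 'I_(n * n)}) :
    set 'cV[R]_(n * n) :=
  [set d | [/\ forall i, 0 <= (x + d) i 0, ot_mx R n *m d = 0
             & forall i, i \notin I -> d i 0 = 0]].

Definition block_optimal (C : 'M[R]_n) (x : 'cV[R]_(n * n))
    (I : {set 'I_(n * n)}) : set 'cV[R]_(n * n) :=
  minimizers (dotp (vec C)) (block_feasible x I).

(* For feasible x the infimum is over a nonempty set (it contains the value
   at 0) that is bounded below (the transportation polytope is compact), so
   the default value of [inf] is never used. *)
Definition block_value (C : 'M[R]_n) (x : 'cV[R]_(n * n))
    (I : {set 'I_(n * n)}) : R :=
  inf (dotp (vec C) @` block_feasible x I).

End OptimalTransport.

Section Selection.
Variables (R : realType) (n : nat).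

(* Law of f u for u uniformly distributed in the finite set E. *)
Definition uniform_law (U V : finType) (E : {set U}) (f : U -> V) (y : V) : R :=
  #|[set u : U | (u \in E) && (f u == y)]%SET|%:R / #|E|%:R.

(* The row and column numbers are i.+1 and j.+1. *)
Definition band_mx (p : nat) : 'M[R]_n :=
  \matrix_(i < n, j < n)
    (let a := i.+1 in let b := j.+1 in
     ((1 <= b <= n - p + 1) && (b <= a <= b + p - 1)
      || (n - p + 2 <= b <= n) &&
         ((1 <= a <= b + p - n - 1) || (b <= a <= n)))%N)%:R.

Definition band_block (p : nat) (st : 'S_n * 'S_n) : {set 'I_(n * n)} :=
  supp (vec (row_perm st.1 (col_perm st.2 (band_mx p)))).

Definition band_law (p : nat) : {set 'I_(n * n)} -> R :=
  uniform_law [set: 'S_n * 'S_n]%SET (band_block p).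

Definition submx_block (KL : {set 'I_n} * {set 'I_n}) : {set 'I_(n * n)} :=
  supp (vec (\matrix_(i < n, j < n)
               ((i \in KL.1) && (j \in KL.2))%:R : 'M[R]_n)).

Definition submx_law (m : nat) : {set 'I_(n * n)} -> R :=
  uniform_law
    [set KL : {set 'I_n} * {set 'I_n} | (#|KL.1| == m) && (#|KL.2| == m)]%SET
    submx_block.

Definition block_law (m p : nat) (s : R) (J : {set 'I_(n * n)}) : R :=
  s * band_law p J + (1 - s) * submx_law m J.

End Selection.

Section ConditionalExpectation.
Context (disp : measure_display) (T : measurableType disp) (R : realType).
Variables (P : probability T R) (F : set_system T).

Definition is_cond_exp (X Y : T -> R) : Prop :=
  [/\ P.-integrable setT (EFin \o X),
      P.-integrable setT (EFin \o Y),
      forall B : set R, measurable B -> F (Y @^-1` B)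
    & forall A, F A ->
        (\int[P]_(w in A) (Y w)%:E = \int[P]_(w in A) (X w)%:E)%E].

Definition cond_exp_le (X Z : T -> R) : Prop :=
  (exists Y, is_cond_exp X Y) /\
  (forall Y, is_cond_exp X Y -> {ae P, forall w, Y w <= Z w}).

End ConditionalExpectation.

Section Algorithm.
Context (disp : measure_display) (T : measurableType disp) (R : realType).
Variables (P : probability T R) (n : nat).
Variables (x d : nat -> T -> 'cV[R]_(n * n)) (I : nat -> T -> {set 'I_(n * n)}).

Definition iterate_events (k : nat) : set_system T :=
  [set E | exists j i (B : set R),
     [/\ (j <= k)%N, measurable B & E = (fun w => x j w i 0) @^-1` B]].

Definition block_events (k : nat) : set_system T :=
  [set E | exists j (J : {set 'I_(n * n)}), (j < k)%N /\ E = I j @^-1` [set J]].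

Definition history (k : nat) : set_system T := <<s iterate_events k >>.

(* Everything that has happened before the block of iteration k is drawn. *)
Definition past (k : nat) : set_system T :=
  <<s iterate_events k `|` block_events k >>.

Record rbcd_run (C : 'M[R]_n) (m p : nat) (s : R) (X0 : 'M[R]_n) : Prop := {
  run_measurable_iterate :
    forall k i, measurable_fun setT (fun w => x k w i 0) ;
  run_measurable_block : forall k J, measurable (I k @^-1` [set J]) ;
  run_start : forall w, x 0%N w = vec X0 ;
  run_block : forall k J B, past k B ->
    P (I k @^-1` [set J] `&` B) = ((block_law m p s J)%:E * P B)%E ;
  run_direction : forall k w, block_optimal C (x k w) (I k w) (d k w) ;
  run_step : forall k w, x k.+1 w = x k w + d k w }.

Definition expected_GSq (C : 'M[R]_n) (v : R) : Prop :=
  forall k, cond_exp_le P (history k)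
    (fun w => block_value C (x k w) (I k w))
    (fun w => v * block_value C (x k w) [set: 'I_(n * n)]%SET).

End Algorithm.

(* Main.v *)
(** Along the bipartite graph of its nonzero entries, a direction with zero row
    and column sums splits into at most [n^2 - 3] sign-conformal multiples of
    simple cycles: each cycle cancels an entry, and the last one has at least
    four.  A simple cycle can be folded into a band of width 3, so at least
    [n (p - 2)] of the [n!^2] pairs of permutations move the band over it.
    Hence the diagonal band selection realises, on average, a fraction
    [n (p - 2) / ((n^2 - 3) n!^2)] of the decrease possible with all blocks.
    Since [q(x; N)] is minus the optimality gap of [x], the mean gap contracts
    by the factor [1 - v]; and the gaps decrease along each trajectory, to a
    limit whose mean is zero. *)
Require Import Defs.
From HB Require Import structures.
From mathcomp Require Import all_boot all_order all_algebra all_fingroup.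
From mathcomp Require Import all_classical all_reals all_analysis.
From mathcomp Require Import measurable_realfun zify lra ring.

Set Implicit Arguments.
Unset Strict Implicit.
Unset Printing Implicit Defensive.

Import Order.TTheory GRing.Theory Num.Theory.
Import numFieldNormedType.Exports.

Local Open Scope classical_set_scope.
Local Open Scope ring_scope.

(** * Cycles and circulations *)

(** A new point [x] is corrected by the transposition of [s x] and [f x]. It keeps the earlier
    values, which differ from [s x] by injectivity of [s] and from [f x] by that of [f]. *)
Lemma perm_extending (T : finType) (S : seq T) (f : T -> T) :
  {in S &, injective f} -> exists s : {perm T}, {in S, s =1 f}.
Proof.
elim: S => [|x S IH] finj; first by exists 1%g.
have [|s sf] := IH.
  by move=> y z yS zS; apply: finj; rewrite inE ?yS ?zS orbT.
have [xS|xS] := boolP (x \in S).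
  by exists s => y; rewrite inE => /predU1P[->|]; exact: sf.
exists (s * tperm (s x) (f x))%g => y; rewrite inE permM.
case/predU1P=> [->|yS]; first by rewrite tpermL.
rewrite (sf y yS) tpermD //; apply: contra xS => /eqP.
  by rewrite -(sf y yS) => /perm_inj ->.
by move=> /finj ->//; rewrite inE ?eqxx ?yS ?orbT.
Qed.

(** The orbit of [x] runs back into itself at some index [i]; dropping its first [i] points leaves a
    cycle. *)
Lemma exists_cycle (T : finType) (f : T -> T) (x : T) :
  exists i k, [/\ (0 < k)%N, iter k f (iter i f x) = iter i f x
                & uniq (traject f (iter i f x) k)].
Proof.
have /trajectP[i lti e] := looping_order f x.
exists i, (fingraph.order f x - i)%N; rewrite subn_gt0 -iterD subnK ?(ltnW lti)//.
split=> //; have := orbit_uniq f x.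
rewrite /fingraph.orbit -[X in traject f x X](subnKC (ltnW lti)) trajectD cat_uniq.
by case/and3P.
Qed.

Section Cycle.
Variables (T : eqType) (f : T -> T) (y : T) (k : nat).
Hypotheses (k0 : (0 < k)%N) (fk : iter k f y = y) (uS : uniq (traject f y k)).

Lemma index_cycle r : r \in traject f y k ->
  index (f r) (traject f y k) = ((index r (traject f y k)).+1 %% k)%N.
Proof.
have idx a : (a < k)%N -> index (iter a f y) (traject f y k) = a.
  by move=> ak; rewrite -(nth_traject f ak) index_uniq ?size_traject.
move=> /trajectP[a ak ->]; rewrite idx// -iterS.
have := ak; rewrite leq_eqVlt => /predU1P[->|ak1].
  by rewrite modnn fk -[y in LHS]/(iter 0 f y) idx.
by rewrite idx// modn_small.
Qed.

Lemma perm_cycle : perm_eq (map f (traject f y k)) (traject f y k).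
Proof.
have mapf z l : map f (traject f z l) = traject f (f z) l.
  by elim: l z => //= l IH z; rewrite IH.
rewrite mapf -(perm_cons y) -trajectS trajectSr fk.
by rewrite perm_rcons.
Qed.

(** Mapping the cycle by [f] rearranges it, so the image list is again free of duplicates. *)
Lemma cycle_inj : {in traject f y k &, injective f}.
Proof.
move=> a b aS bS; move: (perm_cycle) => /perm_uniq; rewrite uS.
move=> /(uniqP y) inj e.
have [ia ib] := (aS, bS); move: ia ib; rewrite -!index_mem => ia ib.
have : index a (traject f y k) = index b (traject f y k).
  by apply: inj; rewrite ?inE ?size_map// !(nth_map y)// !nth_index.
by move=> /(congr1 (nth y (traject f y k))); rewrite !nth_index.
Qed.

End Cycle.

(** The tridiagonal positions [|a - b| <= 1]. A shift of the rows by one makes them part of a band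
    that starts on the diagonal and goes down, like that of [band_mx]. *)
Definition adjacent (a b : nat) := ((a <= b.+1) && (b <= a.+1))%N.

(* Going once around the cycle [r_0, c_0, r_1, c_1, ...] of length [2k], the
   vertex number [u] is placed at the level [min u (2k-1-u)]; consecutive
   vertices then differ by at most one level, and every level contains exactly
   one row and one column. *)
Lemma cycle_band n (f c : 'I_n -> 'I_n) y k :
    (0 < k)%N -> iter k f y = y -> uniq (traject f y k) ->
    {in traject f y k &, injective c} ->
  exists st : 'S_n * 'S_n, {in traject f y k, forall r,
    adjacent (st.1 r) (st.2 (c r)) && adjacent (st.1 (f r)) (st.2 (c r))}.
Proof.
set S := traject f y k => k0 fk uS cinj.
have kn : (k <= n)%N.
  by rewrite -(size_traject f y k) -(card_uniqP uS) -[leqRHS]card_ord max_card.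
pose lev u := minn u (k.*2 - u.+1).
have levk u : (u < k.*2)%N -> (lev u < n)%N.
  by rewrite /lev; lia.
have iS r : r \in S -> (index r S < k)%N.
  by rewrite -index_mem size_traject.
have icS r : r \in S -> index (c r) (map c S) = index r S.
  move=> rS; rewrite -{1}(nth_index y rS) -(nth_map _ y) ?index_mem//.
  by rewrite index_uniq ?size_map ?index_mem// map_inj_in_uniq.
(* Row number [i] of the cycle is vertex [2i] and its column is vertex [2i+1]. Their levels are
   below [k <= n], so [insubd] never falls back on [y] there. *)
have rowE r : r \in S ->
    insubd y (lev (index r S).*2) = lev (index r S).*2 :> nat.
  by move=> rS; rewrite val_insubd levk// ltn_double iS.
have colE r : r \in S ->
    insubd y (lev (index (c r) (map c S)).*2.+1) = lev (index r S).*2.+1 :> nat.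
  by move=> rS; rewrite val_insubd icS// levk//; have := iS _ rS; lia.
have idx_inj a b : a \in S -> b \in S -> index a S = index b S -> a = b.
  by move=> aS bS e; rewrite -(nth_index y aS) e nth_index.
have [|s sE] := @perm_extending _ S (fun r => insubd y (lev (index r S).*2)).
  move=> a b aS bS /(congr1 val) /=; rewrite !rowE// => e; apply: idx_inj => //.
  by move: e (iS _ bS) (iS _ aS); rewrite /lev; lia.
have [|t tE] := @perm_extending _ (map c S)
    (fun j => insubd y (lev (index j (map c S)).*2.+1)).
  move=> _ _ /mapP[a aS ->] /mapP[b bS ->] /(congr1 val) /=.
  rewrite !colE// => e; congr c; apply: idx_inj => //.
  by move: e (iS _ bS) (iS _ aS); rewrite /lev; lia.
exists (s, t) => r rS /=.
have frS : f r \in S by rewrite -(perm_mem (perm_cycle fk)) map_f.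
have rk := iS _ rS; have frk := iS _ frS.
rewrite !sE// tE ?map_f// colE// !rowE//.
rewrite index_cycle// -/S /adjacent /lev.
(* Where the cycle closes, the vertices [2k-1] and 0 are both at level 0. *)
have [e|e] := eqVneq (index r S).+1 k; first by rewrite e modnn; lia.
by rewrite modn_small; lia.
Qed.

Section Circulation.
Variables (R : realDomainType) (n : nat).
Implicit Types D H : 'M[R]_n.

Definition balanced D : Prop :=
  (forall i, \sum_j D i j = 0) /\ (forall j, \sum_i D i j = 0).

(** Each entry of [H] lies between 0 and that of [D]. Hence if [x] and [x + D] are nonnegative, so
    is [x + H]: the pieces of a feasible direction remain feasible. *)
Definition conformal H D : Prop :=
  forall i j, (0 <= H i j <= D i j) || (D i j <= H i j <= 0).

Definition mxsupp D : {set 'I_n * 'I_n} := [set e | D e.1 e.2 != 0]%SET.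

Lemma sum0_gt0 (F : 'I_n -> R) i :
  \sum_i F i = 0 -> F i < 0 -> exists j, 0 < F j.
Proof.
move=> F0 Fi; apply/existsP; apply: contraLR Fi => /existsPn F_le0.
have FN k : 0 <= - F k by rewrite oppr_ge0 leNgt F_le0.
rewrite -leNgt -oppr_le0 -(eqP (_ : \sum_i - F i == 0)); last first.
  by rewrite sumrN F0 oppr0.
by rewrite (bigD1 i)//= lerDl sumr_ge0.
Qed.

Lemma sum0_lt0 (F : 'I_n -> R) i :
  \sum_i F i = 0 -> 0 < F i -> exists j, F j < 0.
Proof.
move=> F0 Fi; have [||j] := @sum0_gt0 (fun i => - F i) i.
- by rewrite sumrN F0 oppr0.
- by rewrite oppr_lt0.
- by rewrite oppr_gt0; exists j.
Qed.

Lemma conformal_trans H D' D : conformal H D' -> conformal D' D -> conformal H D.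
Proof. by move=> HD' D'D i j; move: (HD' i j) (D'D i j); lra. Qed.

Lemma conformal_sub H D : conformal H D -> conformal (D - H) D.
Proof. by move=> HD i j; move: (HD i j); rewrite !mxE; lra. Qed.

Lemma balancedB D H : balanced D -> balanced H -> balanced (D - H).
Proof.
by move=> [rD cD] [rH cH]; split=> i; (under eq_bigr do rewrite !mxE);
  rewrite sumrB ?(rD, cD) ?(rH, cH) subrr.
Qed.

(* Alternate between a positive entry in the current row and a negative entry
   in its column until a row is repeated. *)
Lemma conformal_cycle D : balanced D -> D != 0 ->
  (4 <= #|mxsupp D|)%N /\
  exists H (st : 'S_n * 'S_n),
    [/\ balanced H, conformal H D, (#|mxsupp (D - H)| < #|mxsupp D|)%N
      & forall i j, H i j != 0 -> adjacent (st.1 i) (st.2 j)].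
Proof.
move=> [rD cD] D0.
(* The defaults are harmless: in an active row both choices succeed, and [f] maps active rows to
   active rows. *)
pose c r := odflt r [pick j | 0 < D r j].
pose g j := odflt j [pick i | D i j < 0].
pose f r := g (c r).
pose active r := exists j, 0 < D r j.
have cP r : active r -> 0 < D r (c r).
  by rewrite /c => -[j Dj]; case: pickP => [//|/(_ j)]; rewrite Dj.
have fP r : active r -> D (f r) (c r) < 0.
  move=> /cP /(sum0_lt0 (cD _))[i Di].
  by rewrite /f /g; case: pickP => [//|/(_ i)]; rewrite Di.
have factive r : active r -> active (f r).
  by move=> /fP /(sum0_gt0 (rD _)).
have [r1 r1A] : exists r, active r.
  have /matrix0Pn[i [j]] := D0; rewrite neq_lt => /orP[Dij|Dij].
    by have [i' ?] := sum0_gt0 (cD _) Dij; exists i', j.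
  by exists i, j.
have [i [k [k0 fk uS]]] := exists_cycle f r1.
set y := iter i f r1 in fk uS; set S := traject f y k in uS.
have SA r : r \in S -> active r.
  move=> /trajectP[a _ ->]; rewrite /y -iterD.
  by elim: (a + i)%N => //= l; exact: factive.
have fS r : r \in S -> f r \in S.
  by move=> rS; rewrite -(perm_mem (perm_cycle fk)) map_f.
have yS : y \in S by apply/trajectP; exists 0%N.
have cinj : {in S &, injective c}.
  move=> a b aS bS cab; apply: (cycle_inj fk uS) => //.
  by rewrite /f cab.
have rf r : r \in S -> (r == f r) = false.
  move=> /SA rA; apply/negbTE/eqP => e.
  by have := lt_trans (fP _ rA) (cP _ rA); rewrite -e ltxx.
have neq0 r : r \in S -> (D r (c r) != 0) && (D (f r) (c r) != 0).
  by move=> /SA rA; rewrite gt_eqF ?lt_eqF ?fP ?cP.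
split.
  (* Two consecutive rows of the cycle and their columns provide four distinct nonzero entries, even
     if the cycle has only two rows. *)
  have cy : (c y == c (f y)) = false.
    by apply/negbTE/eqP => /(cinj _ _ yS (fS _ yS))/eqP; rewrite rf.
  have := rf _ (fS _ yS); have := rf _ yS.
  have /andP[] := neq0 _ yS; have /andP[] := neq0 _ (fS _ yS).
  set y' := f y in cy *; set y'' := f y' => D1 D2 D3 D4 e1 e2.
  have u4 : uniq [:: (y, c y); (y', c y); (y', c y'); (y'', c y')].
    by rewrite /= !inE !xpair_eqE !eqxx e1 e2 cy !andbF.
  have /card_uniqP/= <- := u4; apply/subset_leq_card/fintype.subsetP => e.
  by rewrite !inE => /or4P[]/eqP ->.
(* The minimum [t] of [w] is the largest amount that can be pushed around the cycle: [H] has [t] at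
   [(r, c r)] and [-t] at [(f r, c r)]. At [r0], where the minimum is attained, an entry of [D] is
   cancelled. *)
pose w r := Num.min (D r (c r)) (- D (f r) (c r)).
have [r0 r0S wmin] := @Order.TotalTheory.arg_minP _ _ _ y (mem S) w yS.
pose t := w r0.
have t_ge0 : 0 <= t.
  by rewrite le_min oppr_ge0 (ltW (cP _ (SA _ r0S))) (ltW (fP _ (SA _ r0S))).
pose H : 'M[R]_n :=
  \matrix_(i, j) \sum_(r <- S) ((i == r)%:R - (i == f r)%:R) * (j == c r)%:R * t.
have HE i' r : r \in S -> H i' (c r) = ((i' == r)%:R - (i' == f r)%:R) * t.
  move=> rS; rewrite mxE (big_rem r)//= eqxx mulr1 big1_seq ?addr0// => l.
  rewrite (mem_rem_uniq _ uS) => /andP[_ /andP[lr lS]].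
  have [/(cinj _ _ rS lS) e|_] := eqVneq (c r) (c l); last by rewrite mulr0 mul0r.
  by rewrite e eqxx in lr.
have H0 i' j : j \notin map c S -> H i' j = 0.
  move=> jS; rewrite mxE big1_seq// => l /andP[_ lS].
  have [e|_] := eqVneq j (c l); last by rewrite mulr0 mul0r.
  by rewrite e map_f in jS.
have sum_eq (j : 'I_n) : \sum_i (i == j)%:R = 1 :> R.
  by rewrite (bigD1 j)//= eqxx big1 ?addr0// => l /negPf ->.
have HD : conformal H D.
  move=> i' j; have [/mapP[r rS ->]|jS] := boolP (j \in map c S); last first.
    by rewrite H0// lexx andbT le_total.
  rewrite HE//; have : t <= w r := wmin _ rS; rewrite le_min => /andP[t1 t2].
  have [->|_] := eqVneq i' r; first by rewrite rf//= subr0 mul1r t1 t_ge0.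
  have [->|_] := eqVneq i' (f r); last by rewrite subrr mul0r lexx andbT le_total.
  by rewrite sub0r mulN1r oppr_le0 t_ge0 [D _ _ <= _]lerNr t2 orbT.
have [st stP] := cycle_band k0 fk uS cinj.
exists H, st; split => //.
(* In a row the contributions [t] and [-t] cancel because [f] permutes the cycle; in a column they
   cancel for each [r] separately. *)
- split=> j.
    under eq_bigr do rewrite mxE.
    rewrite exchange_big/=.
    under eq_bigr do rewrite -mulr_suml -mulr_sumr sum_eq mulr1.
    rewrite -mulr_suml sumrB -(big_map f xpredT (fun r => (j == r)%:R)).
    by rewrite (perm_big _ (perm_cycle fk)) subrr mul0r.
  under eq_bigr do rewrite mxE.
  rewrite exchange_big/= big1// => r _.
  by rewrite -!mulr_suml sumrB !sum_eq subrr !mul0r.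
- apply: proper_card; rewrite properE; apply/andP; split.
    apply/fintype.subsetP => e; rewrite !inE; apply: contra => /eqP De.
    by move: (conformal_sub HD e.1 e.2); rewrite De -eq_le orbb eq_sym.
  apply/fintype.subsetPn.
  have DH a b : (D - H) a b = D a b - H a b by rewrite [LHS]mxE [X in _ + X]mxE.
  have /andP[D1 D2] := neq0 _ r0S; have r0f := rf _ r0S.
  have [t1|t1] := leP (D r0 (c r0)) (- D (f r0) (c r0)).
    exists (r0, c r0); rewrite inE//= DH HE// eqxx r0f subr0 mul1r.
    by rewrite /t /w min_l// subrr eqxx.
  exists (f r0, c r0); rewrite inE//= DH HE// eqxx (eq_sym (f r0)) r0f sub0r.
  rewrite mulN1r opprK.
  by rewrite /t /w min_r ?(ltW t1)// subrr eqxx.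
- move=> a b Hab; have : b \in map c S by apply: contraNT Hab => /H0 ->.
  move=> /mapP[r rS e]; move: Hab; rewrite e HE//.
  have /andP[st1 st2] := stP _ rS.
  have [->//|_] := eqVneq a r; have [->//|_] := eqVneq a (f r).
  by rewrite subrr mul0r eqxx.
Qed.

(* Peeling off cycles one by one, the last of them having at least 4 entries. *)
Lemma cycle_bound (V : R) (L : 'M[R]_n -> R) D :
    (forall D H, L (D - H) = L D - L H) ->
    balanced D ->
    (forall H (st : 'S_n * 'S_n), balanced H -> conformal H D ->
      (forall i j, H i j != 0 -> adjacent (st.1 i) (st.2 j)) -> L H <= V) ->
    0 <= V -> L D <= (n%:R ^+ 2 - 3) * V \/ D = 0.
Proof.
move=> LB Dbal LV V0.
have card_le E : (#|mxsupp E| <= n ^ 2)%N.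
  by rewrite (leq_trans (max_card _))// card_prod card_ord mulnn.
have [->|D0] := eqVneq D 0; [by right|left].
(* The induction is on the size of the support: every cycle lowers it by at least one, and the last
   cycle, with a support of at least 4, is paid for by [4 - 3 = 1]. *)
suff : L D <= (#|mxsupp D|%:R - 3) * V.
  move=> /le_trans -> //; rewrite ler_wpM2r// lerB// -natrX ler_nat//.
have [l] := ubnP #|mxsupp D|; elim: l => // l IH in D Dbal LV D0 *.
rewrite ltnS => Dl; have [D4 [H [st [Hbal HD DH Hst]]]] := conformal_cycle Dbal D0.
have LH := LV _ _ Hbal HD Hst.
have [e|E0] := eqVneq (D - H) 0.
  have -> : L D = L H.
    have L0 : L 0 = 0 by rewrite -(subrr 0) LB subrr.
    by move: L0; rewrite -e LB => /eqP; rewrite subr_eq0 => /eqP.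
  rewrite (le_trans LH)// ler_peMl//.
  by move: D4; rewrite -(ler_nat R); move: (#|_|%:R) => a; clear; lra.
have IHDH : L (D - H) <= (#|mxsupp (D - H)|%:R - 3) * V.
  apply: IH (balancedB Dbal Hbal) _ E0 (leq_trans DH Dl) => H' st' b cf.
  by apply: LV => //; exact: conformal_trans cf (conformal_sub HD).
rewrite -[L D](subrK (L H)) -LB (le_trans (lerD IHDH LH))//.
rewrite -[X in _ + X]mul1r -mulrDl ler_wpM2r//.
move: DH; rewrite -(ler_nat R) -addn1 natrD.
by move: (#|_|%:R) (#|_|%:R) => a b; clear; lra.
Qed.

End Circulation.

(** * The band selection *)

Section Band.
Variables (n : nat).

Lemma shift_subproof (t : nat) (i : 'I_n) : ((i + t) %% n < n)%N.
Proof. by rewrite ltn_mod (leq_ltn_trans _ (ltn_ord i)). Qed.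

Definition shift (t : nat) (i : 'I_n) : 'I_n := Ordinal (shift_subproof t i).

Lemma shift_inj t : injective (shift t).
Proof.
move=> i j /(congr1 val) /= /eqP; rewrite eqn_modDr !modn_small// => /eqP.
exact: val_inj.
Qed.

Definition shift_perm t : 'S_n := perm (@shift_inj t).

Lemma shift_perm_inj t u :
  (t < n)%N -> (u < n)%N -> shift_perm t = shift_perm u -> t = u.
Proof.
move=> tn un /permP/(_ (Ordinal tn)); rewrite !permE => /(congr1 val)/= /eqP.
by rewrite eqn_modDl !modn_small// => /eqP.
Qed.

(** The columns move by [te.1], the rows by a further 1 to [p - 2]. This takes the differences -1,
    0, 1 of adjacent positions into the range from 0 to [p - 1] of the band, in [n (p - 2)] ways. *)
Definition shift_pair p (st : 'S_n * 'S_n) (te : 'I_n * 'I_(p - 2)) : 'S_n * 'S_n :=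
  ((st.1 * shift_perm ((te.1 + te.2.+1) %% n))%g, (st.2 * shift_perm te.1)%g).

(** The column shift determines [te.1]; the row shift then determines [te.2], since [p - 2 < n]. *)
Lemma shift_pair_inj p st : (p <= n)%N -> injective (@shift_pair p st).
Proof.
move=> pn [t e] [t' e'] [] /mulgI/shift_perm_inj se /mulgI/shift_perm_inj.
move=> /(_ (ltn_ord _) (ltn_ord _)) tt'; congr pair; apply: val_inj => //=.
have n0 : (0 < n)%N by case: n t {se tt'} => [[]|].
move: se; rewrite !ltn_mod tt' => /(_ n0 n0)/eqP.
have ep := ltn_ord e; have ep' := ltn_ord e'.
by rewrite eqn_modDl !modn_small; lia.
Qed.

(** The two cases in the definition of the band are columns without and with wrap-around:
    cyclically, column [b] always occupies the [p] rows from [b] on. *)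
Lemma band_mxE (R : realType) p (a b : 'I_n) e :
  (e < p <= n)%N -> a = ((b + e) %% n)%N :> nat -> band_mx R n p a b = 1.
Proof.
move=> ep ab; rewrite mxE /=; have bn := ltn_ord b.
suff -> : ((1 <= b.+1 <= n - p + 1) && (b.+1 <= a.+1 <= b.+1 + p - 1)
      || (n - p + 2 <= b.+1 <= n) &&
         ((1 <= a.+1 <= b.+1 + p - n - 1) || (b.+1 <= a.+1 <= n)))%N by [].
have [lt|ge] := ltnP (b + e) n.
  by rewrite modn_small// in ab; lia.
have {}ab : a = (b + e - n)%N :> nat.
  by rewrite ab -{1}(subnK ge) modnDr modn_small//; lia.
by lia.
Qed.

Lemma band_mx_shift (R : realType) p (st : 'S_n * 'S_n) te (i j : 'I_n) :
  (3 <= p <= n)%N -> adjacent (st.1 i) (st.2 j) ->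
  band_mx R n p ((@shift_pair p st te).1 i) ((shift_pair st te).2 j) = 1.
Proof.
case: te => t e /= pn; rewrite /adjacent => adj.
(* Adjacency and [e < p - 2] put this offset between 0 and [p - 1]; in particular the truncated
   subtraction is exact. *)
apply: (@band_mxE _ _ _ _ (st.1 i + e.+1 - st.2 j)).
  by have := ltn_ord e; lia.
rewrite !permM !permE /= modnDml modnDmr; congr (_ %% _)%N; lia.
Qed.

End Band.

(** * Directions as vectors and as matrices *)

Section Vec.
Variables (R : realType) (n : nat).
Implicit Types D H : 'M[R]_n.

Definition unvec (x : 'cV[R]_(n * n)) : 'M[R]_n := (vec_mx x^T)^T.

Lemma unvecK x : vec (unvec x) = x.
Proof. by rewrite /vec /unvec trmxK vec_mxK trmxK. Qed.

Lemma vecE D i j : vec D (mxvec_index j i) 0 = D i j.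
Proof. by rewrite mxE mxvecE mxE. Qed.

Lemma vecB D H : vec (D - H) = vec D - vec H.
Proof. by rewrite /vec !linearB. Qed.

Lemma vec0 : vec 0 = 0 :> 'cV[R]_(n * n).
Proof. by rewrite /vec !linear0. Qed.

Lemma ot_mx_eq0 D : ot_mx R n *m vec D = 0 <-> balanced D.
Proof.
rewrite ot_mx_vec; split=> [/eqP|[rD cD]].
  rewrite col_mx_eq0 => /andP[/eqP/colP rD /eqP/colP cD].
  by split=> i; [have := rD i|have := cD i]; rewrite !mxE.
by apply/eqP; rewrite col_mx_eq0; apply/andP; split; apply/eqP/colP => i;
  rewrite !mxE.
Qed.

Lemma dotpB (N : nat) (c x y : 'cV[R]_N) : dotp c (x - y) = dotp c x - dotp c y.
Proof. by rewrite /dotp mulmxBr !mxE. Qed.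

Lemma dotpD (N : nat) (c x y : 'cV[R]_N) : dotp c (x + y) = dotp c x + dotp c y.
Proof. by rewrite /dotp mulmxDr !mxE. Qed.

Lemma dotp0 (N : nat) (c : 'cV[R]_N) : dotp c 0 = 0.
Proof. by rewrite /dotp mulmx0 mxE. Qed.

Lemma dotpE (N : nat) (c x : 'cV[R]_N) : dotp c x = \sum_i c i 0 * x i 0.
Proof. by rewrite /dotp mxE; apply: eq_bigr => i _; rewrite mxE. Qed.

Lemma in_band_block p st i j :
  (mxvec_index j i \in band_block R p st) = (band_mx R n p (st.1 i) (st.2 j) != 0).
Proof. by rewrite inE vecE mxE mxE. Qed.

End Vec.

(** * The optimal value over a block, and its mean under the band selection *)

Section BlockValue.
Variables (R : realType) (n : nat) (C : 'M[R]_n) (x : 'cV[R]_(n * n)) (g : R).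
Hypothesis x_ge0 : forall i, 0 <= x i 0.
(** A bound on the decrease possible from [x]; it makes the infimum in [block_value] a genuine
    one. *)
Hypothesis g_lb : forall d,
  block_feasible x [set: 'I_(n * n)]%SET d -> - g <= dotp (vec C) d.
Implicit Types J : {set 'I_(n * n)}.

Lemma block_feasible0 J : block_feasible x J 0.
Proof. by split=> [i||i _]; rewrite ?addr0 ?mulmx0 ?mxE. Qed.

Lemma block_feasibleT J d :
  block_feasible x J d -> block_feasible x [set: 'I_(n * n)]%SET d.
Proof. by move=> [? ? _]; split=> // i; rewrite inE. Qed.

Lemma block_value_ge J b :
  (forall d, block_feasible x J d -> b <= dotp (vec C) d) -> b <= block_value C x J.
Proof.
move=> bd; apply: lb_le_inf.
  by exists (dotp (vec C) 0), 0 => //; exact: block_feasible0.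
by move=> _ [d xd <-]; exact: bd.
Qed.

Lemma block_value_le J d : block_feasible x J d -> block_value C x J <= dotp (vec C) d.
Proof.
move=> xd; apply: ge_inf; last by exists d.
by exists (- g) => _ [e xe <-]; apply: g_lb; exact: block_feasibleT xe.
Qed.

Lemma block_value_le0 J : block_value C x J <= 0.
Proof. by rewrite -(dotp0 (vec C)) block_value_le//; exact: block_feasible0. Qed.

Lemma block_value_lb J : - g <= block_value C x J.
Proof. by apply: block_value_ge => d /block_feasibleT/g_lb. Qed.

Lemma block_value_optimal J d :
  block_optimal C x J d -> block_value C x J = dotp (vec C) d.
Proof.
move=> [xd dmin]; apply/eqP; rewrite eq_le block_value_le//=.
exact: block_value_ge.
Qed.

Lemma band_average p : (3 <= p <= n)%N ->
  \sum_J band_law R p J * block_value C x J <=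
  (n%:R * (p%:R - 2)) / ((n%:R ^+ 2 - 3) * n`!%:R ^+ 2) *
    block_value C x [set: 'I_(n * n)]%SET.
Proof.
move=> pn.
pose q st := block_value C x (band_block R p st).
(* The mean over blocks is rewritten as a mean over pairs of permutations, grouped by the block they
   produce. *)
have -> : \sum_J band_law R p J * block_value C x J =
    (\sum_(st : 'S_n * 'S_n) q st) / n`!%:R ^+ 2.
  have cardE : #|[set: 'S_n * 'S_n]%SET|%:R = n`!%:R ^+ 2 :> R.
    by rewrite cardsT card_prod card_Sn natrM expr2.
  rewrite /band_law /uniform_law cardE mulr_suml.
  rewrite (partition_big (band_block R p) xpredT)//=; apply: eq_bigr => J _.
  rewrite (eq_bigr (fun=> block_value C x J / n`!%:R ^+ 2)); last first.
    by move=> st /eqP <-.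
  rewrite sumr_const -mulrAC -mulrA mulr_natl; congr (_ *+ _).
  by apply: eq_card => st; rewrite !inE.
have n3 : 3 <= n%:R :> R by rewrite ler_nat; lia.
have p3 : 0 < p%:R - 2 :> R by rewrite subr_gt0 ltr_nat; lia.
have f0 : 0 < n`!%:R :> R by rewrite ltr0n fact_gt0.
have n23 : 0 < n%:R ^+ 2 - 3 :> R by nra.
(* [V] bounds the decrease along a single cycle: at least [n (p - 2)] pairs produce a block
   containing the cycle, and the other terms of the sum are nonpositive. By [cycle_bound], no
   direction then decreases the cost by more than [(n^2 - 3) V]. *)
pose V := (- \sum_st q st) / (n%:R * (p%:R - 2)).
have V0 : 0 <= V.
  apply: divr_ge0; last by rewrite mulr_ge0// ltW.
  rewrite oppr_ge0 sumr_le0// => st _.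
  exact: block_value_le0.
have Vlb : - ((n%:R ^+ 2 - 3) * V) <= block_value C x [set: 'I_(n * n)]%SET.
  apply: block_value_ge => d [xd0 Ad _]; rewrite lerNl.
  rewrite -(unvecK d) in xd0 Ad *; set D := unvec d in xd0 Ad *.
  have Dbal : balanced D by exact/ot_mx_eq0.
  pose L H := - dotp (vec C) (vec H).
  have LB E H : L (E - H) = L E - L H by rewrite /L vecB dotpB opprB opprK addrC.
  suff LV H (st : 'S_n * 'S_n) : balanced H -> conformal H D ->
      (forall i j, H i j != 0 -> adjacent (st.1 i) (st.2 j)) -> L H <= V.
    have [//|->] := cycle_bound LB Dbal LV V0.
    by rewrite vec0 dotp0 oppr0 mulr_ge0// ltW.
  move=> Hbal HD Hst; rewrite /L.
  {
    have fH (te : 'I_n * 'I_(p - 2)) :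
        block_feasible x (band_block R p (shift_pair st te)) (vec H).
      split; last 2 first.
      + exact/ot_mx_eq0.
      + case/mxvec_indexP => j i; rewrite in_band_block negbK vecE => bs.
        apply: contraTeq bs => /Hst adj.
        by rewrite band_mx_shift// oner_neq0.
      + case/mxvec_indexP => j i; rewrite mxE vecE.
        have := xd0 (mxvec_index j i); rewrite mxE vecE.
        by move: (HD i j) (x_ge0 (mxvec_index j i)); clear; lra.
    rewrite ler_pdivlMr ?mulr_gt0//; last by rewrite (lt_le_trans _ n3).
    rewrite mulNr lerN2.
    have inj := @shift_pair_inj n p st (proj2 (andP pn)).
    rewrite (bigID [in [set shift_pair st te | te : 'I_n * 'I_(p - 2)]%SET])/=.
    rewrite -[leRHS]addr0 lerD// ?sumr_le0// => [|? _]; last exact: block_value_le0.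
    rewrite big_imset/=; last by move=> ? ? _ _; exact: inj.
    rewrite (le_trans (ler_sum _ (fun te _ => block_value_le (fH te))))//.
    rewrite sumr_const card_prod !card_ord -[_ *+ (n * _)]mulr_natr natrM natrB//.
    by lia.
  }
set Q := block_value _ _ _ in Vlb *; set S := \sum_st q st in V Vlb V0 *.
set K := _ * (_ - _) in V Vlb V0 *; set E := _ - 3 in n23 Vlb *.
have K0 : 0 < K by rewrite mulr_gt0// (lt_le_trans _ n3).
have -> : S = - (E * V) * (K / E).
  by rewrite /V; field; rewrite !gt_eqF.
have -> : K / (E * n`!%:R ^+ 2) * Q = Q * (K / E) / n`!%:R ^+ 2.
  by field; rewrite !gt_eqF.
rewrite ler_pM2r ?invr_gt0 ?exprn_gt0//.
by rewrite ler_pM2r// divr_gt0.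
Qed.

End BlockValue.

(** * Measurability of the optimal value *)

(** Take the largest lower bound, or without lower bounds the smallest upper bound, or else 0. This
    is the value given to an eliminated unknown. *)
Lemma exists_between (R : realDomainType) (I : finType) (L U : pred I) (l u : I -> R) :
  (forall i j, U i -> L j -> l j <= u i) ->
  exists t, (forall i, U i -> t <= u i) /\ (forall j, L j -> l j <= t).
Proof.
move=> lu; case: (pickP L) => [j0 Lj0|L0].
  case: (Order.TotalTheory.arg_maxP l Lj0) => j Lj jmax.
  by exists (l j); split=> [i Ui|]; [exact: lu|exact: jmax].
case: (pickP U) => [i0 Ui0|U0].
  case: (Order.TotalTheory.arg_minP u Ui0) => i Ui imin.
  by exists (u i); split=> [|j]; [exact: imin|rewrite L0].
by exists 0; split=> i; rewrite ?L0 ?U0.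
Qed.

Section FourierMotzkin.
Context (disp : measure_display) (T : measurableType disp) (R : realType).

(* Fourier-Motzkin elimination of the last unknown: a projection of a
   polyhedron is again given by finitely many linear inequalities. *)
Lemma measurable_projection_nat N (I : finType) (a : I -> nat -> R) (b : I -> T -> R) :
    (forall i, measurable_fun setT (b i)) ->
  measurable [set w | exists y : nat -> R,
    forall i, \sum_(k < N) a i k * y k <= b i w].
Proof.
elim: N I a b => [|N IH] I a b mb.
  rewrite (_ : [set w | _] = \bigcap_(i in [set: I]) [set w | 0 <= b i w]).
    apply: fin_bigcap_measurable => // i _; rewrite -[X in measurable X]setTI.
    by apply: (@measurable_fun_le _ _ R setT (cst 0) (b i)).
  rewrite eqEsubset; split=> w /=.
    by move=> [y yb] i _; have := yb i; rewrite big_ord0.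
  by move=> wb; exists (fun=> 0) => i; rewrite big_ord0 wb.
(* Inequalities free of the last unknown are kept, and each upper bound on it is paired with each
   lower bound; all other indices carry the trivial [0 <= 0]. *)
pose a' (e : I + I * I) k := match e with
  | inl i => if a i N == 0 then a i k else 0
  | inr (i, j) =>
    if (0 < a i N) && (a j N < 0) then a i k / a i N - a j k / a j N else 0
  end.
pose b' (e : I + I * I) w := match e with
  | inl i => if a i N == 0 then b i w else 0
  | inr (i, j) =>
    if (0 < a i N) && (a j N < 0) then b i w / a i N - b j w / a j N else 0
  end.
have mb' e : measurable_fun setT (b' e).
  rewrite /b'; case: e => [i|[i j]].
    by case: (a i N == 0); [exact: mb|exact: measurable_cst].
  case: (_ && _); last exact: measurable_cst.
  by apply: measurable_funB; apply: measurable_funM;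
    by [exact: mb|exact: measurable_cst].
have := IH _ a' b' mb'; congr measurable; rewrite eqEsubset.
have sumE (u v y : nat -> R) c c' : \sum_(k < N) (u k / c - v k / c') * y k =
    (\sum_(k < N) u k * y k) / c - (\sum_(k < N) v k * y k) / c'.
  rewrite !mulr_suml -sumrB; apply: eq_bigr => k _.
  by rewrite mulrBl; congr (_ - _); rewrite mulrAC.
split=> w /= [y yb].
  pose s i := \sum_(k < N) a i k * y k.
  have [|t [tU tL]] := @exists_between R I (fun i => a i N < 0) (fun i => 0 < a i N)
     (fun i => (b i w - s i) / a i N) (fun i => (b i w - s i) / a i N).
    move=> i j ai aj; have := yb (inr (i, j)); rewrite /a' /b' ai aj /= sumE.
    by rewrite !mulrBl -/(s i) -/(s j); lra.
  exists (fun k => if k == N then t else y k) => i.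
  rewrite big_ord_recr/= eqxx (eq_bigr (fun k : 'I_N => a i k * y k)); last first.
    by move=> k _; rewrite ltn_eqF.
  have [ai|ai|ai] := ltgtP (a i N) 0.
  - by have := tL i ai; rewrite ler_ndivrMr// /s mulrC; lra.
  - by have := tU i ai; rewrite ler_pdivlMr// /s mulrC; lra.
  - by have := yb (inl i); rewrite /a' /b' ai eqxx mul0r addr0.
exists y => -[i|[i j]] /=.
  case: ifPn => [/eqP ai|_]; last first.
    by rewrite big1// => k _; rewrite mul0r.
  by have := yb i; rewrite big_ord_recr/= ai mul0r addr0.
case: ifPn => [/andP[ai aj]|_]; last first.
  by rewrite big1// => k _; rewrite mul0r.
rewrite sumE; have := yb j; have := yb i; rewrite !big_ord_recr/= -!lerBrDl.
rewrite -ler_pdivlMl// -ler_ndivrMl// => yi yj.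
by have := le_trans yj yi; rewrite !mulrBr ![_^-1 * _]mulrC; lra.
Qed.

Lemma measurable_projection N (I : finType) (a : I -> 'I_N -> R) (b : I -> T -> R) :
    (forall i, measurable_fun setT (b i)) ->
  measurable [set w | exists y : 'cV[R]_N,
    forall i, \sum_k a i k * y k 0 <= b i w].
Proof.
move=> /(measurable_projection_nat N (fun i k => oapp (a i) 0 (insub k))).
congr measurable; rewrite eqEsubset; split=> w /= [y yb].
  exists (\col_k y k) => i; rewrite (le_trans _ (yb i))// le_eqVlt; apply/orP; left.
  by apply/eqP/eq_bigr => k _; rewrite mxE valK.
exists (fun k => oapp (y ^~ 0) 0 (insub k)) => i.
rewrite (le_trans _ (yb i))// le_eqVlt; apply/orP; left.
by apply/eqP/eq_bigr => k _; rewrite valK.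
Qed.

Lemma measurable_fun_ltP (f : T -> R) :
  (forall a, measurable [set w | f w < a]) -> measurable_fun setT f.
Proof.
move=> mf _; apply: (measurability _ (RGenInftyO.measurableE R)) => //.
move=> _ [_ [a ->] <-]; rewrite setTI (_ : _ @^-1` _ = [set w | f w < a])//.
Qed.

(** The value is below [a] exactly if, for some [k], a feasible direction costs at most
    [a - 1/(k+1)]. For each [k] this event is the projection of a polyhedron whose right-hand sides
    are measurable in [w]. *)
Lemma measurable_block_value n (C : 'M[R]_n) (x : T -> 'cV[R]_(n * n)) (g : R)
    (J : {set 'I_(n * n)}) :
    (forall i, measurable_fun setT (fun w => x w i 0)) ->
    (forall w i, 0 <= x w i 0) ->
    (forall w d, block_feasible (x w) [set: 'I_(n * n)]%SET d ->
      - g <= dotp (vec C) d) ->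
  measurable_fun setT (fun w => block_value C (x w) J).
Proof.
move=> mx x0 lb; apply: measurable_fun_ltP => a.
pose E r := [set w | exists d, block_feasible (x w) J d /\ dotp (vec C) d <= r].
have -> : [set w | block_value C (x w) J < a] = \bigcup_k E (a - k.+1%:R^-1).
  rewrite eqEsubset; split=> w /=.
    move=> /inf_lt [|_ [d xd <-] da].
      exists (dotp (vec C) 0); exists 0 => //; exact: block_feasible0.
    have [k dk] := ltr_add_invr da.
    by exists k => //; exists d; split; rewrite // lerBrDr ltW.
  move=> [k _ [d [xd da]]].
  have := block_value_le (lb w) xd => /le_trans/(_ da)/le_lt_trans; apply.
  by rewrite ltrBlDr ltrDl invr_gt0.
apply: bigcupT_measurable => k; move: (a - _) => r.
(* Every equation enters the system as two inequalities, one for each sign. *)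
pose sgn (s : bool) : R := (-1) ^+ s.
pose A (e : option ('I_(n * n) + bool * ('I_(n + n) + 'I_(n * n))))
    (k : 'I_(n * n)) : R :=
  match e with
  | None => vec C k 0
  | Some (inl i) => - (k == i)%:R
  | Some (inr (s, inl i)) => sgn s * ot_mx R n i k
  | Some (inr (s, inr i)) => sgn s * ((i \notin J) && (k == i))%:R
  end.
pose B (e : option ('I_(n * n) + bool * ('I_(n + n) + 'I_(n * n)))) w : R :=
  match e with
  | None => r
  | Some (inl i) => x w i 0
  | Some (inr _) => 0
  end.
have mB e : measurable_fun setT (B e).
  by case: e => [[i|?]|]; [exact: mx|exact: measurable_cst|exact: measurable_cst].
have := measurable_projection A mB; congr measurable; rewrite eqEsubset.
have sum1 (y : 'cV[R]_(n * n)) i : \sum_k (k == i)%:R * y k 0 = y i 0.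
  rewrite (bigD1 i)//= eqxx mul1r big1 ?addr0// => l /negPf ->; exact: mul0r.
have sgn_le (u : R) : (forall s, sgn s * u <= 0) <-> u = 0.
  split=> [su|->]; last by move=> s; rewrite mulr0.
  by have := su true; have := su false; rewrite /sgn expr0 expr1; lra.
split=> w /= [y yP].
  exists y; split; last first.
    by have := yP None; rewrite /A /B dotpE.
  split.
  - move=> i; have := yP (Some (inl i)); rewrite /A /B mxE.
    under eq_bigr do rewrite mulNr.
    by rewrite sumrN sum1; lra.
  - apply/colP => i; rewrite [RHS]mxE mxE; apply/sgn_le => s.
    have := yP (Some (inr (s, inl i))); rewrite /A /B.
    by under eq_bigr do rewrite -mulrA; rewrite -mulr_sumr.
  - move=> i iJ; apply/sgn_le => s.
    have := yP (Some (inr (s, inr i))); rewrite /A /B iJ/=.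
    under eq_bigr do rewrite -mulrA.
    by rewrite -mulr_sumr sum1.
move: yP => [[y0 yA yJ] yr]; exists y => -[[i|[s [i|i]]]|] /=.
- under eq_bigr do rewrite mulNr.
  by rewrite sumrN sum1; have := y0 i; rewrite mxE; lra.
- under eq_bigr do rewrite -mulrA.
  have /colP/(_ i) := yA; rewrite [RHS]mxE mxE -mulr_sumr => ->.
  by rewrite mulr0.
- under eq_bigr do rewrite -mulrA.
  rewrite -mulr_sumr; have [iJ|iJ] := boolP (i \in J) => /=.
    by rewrite big1 ?mulr0// => l _; rewrite mul0r.
  by rewrite sum1 yJ// mulr0.
- by move: yr; rewrite dotpE.
Qed.

End FourierMotzkin.

(** * The random iteration *)

Section SubSigma.
Context (disp : measure_display) (T : measurableType disp) (R : realType).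
Variables (P : probability T R) (G : set_system T).
Hypothesis G_measurable : G `<=` measurable.

Let subG : <<s G >> `<=` (measurable : set_system T).
Proof. exact: smallest_sub (sigma_algebra_measurable T) G_measurable. Qed.

Let T' : measurableType _ := g_sigma_algebraType G.

Lemma measurable_fun_sub d' (U : measurableType d') (f : T' -> U) :
  measurable_fun setT f -> measurable_fun setT (f : T -> U).
Proof.
move=> mf _ B mB; apply: subG; exact: (mf measurableT B mB).
Qed.

Let idT (w : T) : T' := w.

Let measurable_idT : measurable_fun setT idT.
Proof. by move=> _ B mB; rewrite setTI; exact: subG. Qed.

(** On the sigma-algebra generated by [G], restricting [P] to [E] amounts to scaling it by [c].
    Pushing both measures forward along the identity to that coarser space makes them equal, and [f]
    is measurable there. *)
Lemma integral_indep (E A : set T) (c : {nonneg R}) (f : T' -> \bar R) :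
  measurable E -> (forall B, <<s G >> B -> P (E `&` B) = (c%:num%:E * P B)%E) ->
  <<s G >> A -> measurable_fun setT f -> (forall w, (0 <= f w)%E) ->
  (\int[P]_(w in A `&` E) f w = c%:num%:E * \int[P]_(w in A) f w)%E.
Proof.
move=> mE indep GA mf f0.
have mA : measurable A by exact: subG.
pose PE := mrestr P mE.
have mfT : measurable_fun setT (f : T -> \bar R) by exact: measurable_fun_sub.
transitivity (\int[PE]_(w in A `&` E) f w)%E.
  apply: eq_measure_integral => B mB BAE; rewrite /PE/= /mrestr setIidl//.
  by move=> w /BAE [].
transitivity (\int[PE]_(w in A) f w)%E.
  rewrite (@ge0_negligible_integral _ _ _ PE A (~` E))//.
  - by rewrite setDE setCK.
  - exact: measurableC.
  - exact: measurable_funTS.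
  - by rewrite /PE/= /mrestr setICl measure0.
have GA0 : {in A, forall w, (0%R <= f w)%E} by move=> w _; exact: f0.
have mfA : measurable_fun (A : set T') f by exact: measurable_funTS.
rewrite -ge0_integral_mscale//; last exact: measurable_funTS.
apply: etrans (esym (ge0_integral_pushforward measurable_idT PE GA mfA GA0)) _.
apply: etrans _ (ge0_integral_pushforward measurable_idT (mscale c P) GA mfA GA0).
apply: eq_measure_integral => B mB _; rewrite /= /pushforward /PE /mrestr /mscale/=.
by rewrite setIC indep.
Qed.

End SubSigma.

Lemma bounded_integrable (disp : measure_display) (T : measurableType disp)
    (R : realType) (P : probability T R) (A : set T) (f : T -> R) M :
  measurable A -> measurable_fun setT f -> (forall w, `|f w| <= M) ->
  P.-integrable A (EFin \o f).
Proof.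
move=> mA mf fM.
apply: (@le_integrable _ _ _ _ _ mA _ (EFin \o cst M)).
- by apply/measurable_EFinP; exact: measurable_funTS.
- by move=> w _ /=; rewrite lee_fin (le_trans (fM w))// ler_norm.
- exact: finite_measure_integrable_cst.
Qed.

Section Law.
Variables (R : realType) (n : nat).

Lemma uniform_law_ge0 (U V : finType) (E : {set U}) (f : U -> V) y :
  0 <= uniform_law R E f y.
Proof. by rewrite divr_ge0. Qed.

Lemma block_law_ge0 m p (s : R) (J : {set 'I_(n * n)}) :
  0 <= s <= 1 -> 0 <= block_law m p s J.
Proof.
move=> /andP[s0 s1].
by rewrite addr_ge0// mulr_ge0 ?subr_ge0//; exact: uniform_law_ge0.
Qed.

End Law.

(** * The optimality gap along a run *)

Section Run.
Context (disp : measure_display) (T : measurableType disp) (R : realType).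
Variables (P : probability T R) (n m p : nat) (s : R).
Variables (C X0 : 'M[R]_n) (r1 r2 : 'cV[R]_n).
Variables (x d : nat -> T -> 'cV[R]_(n * n)) (I : nat -> T -> {set 'I_(n * n)}).
Hypotheses (hp : (3 <= p <= n)%N) (hs : 0 <= s <= 1).
Hypothesis hX0 : ot_feasible r1 r2 (vec X0).
Hypothesis hrun : rbcd_run P x d I C m p s X0.
Variable xstar : 'cV[R]_(n * n).
Hypothesis hopt : ot_optimal C r1 r2 xstar.

Let gap k w := dotp (vec C) (x k w - xstar).
Let g0 := dotp (vec C) (vec X0 - xstar).
Let value k w J := block_value C (x k w) J.
Let law (J : {set 'I_(n * n)}) : R := block_law m p s J.
Let expected_value k w := \sum_J law J * value k w J.

Lemma run_feasible k w : ot_feasible r1 r2 (x k w).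
Proof.
elim: k => [|k [Ax x0]]; first by rewrite (run_start hrun).
have [[xd0 Ad _] _] := run_direction hrun k w.
by rewrite (run_step hrun); split=> //; rewrite mulmxDr Ax Ad addr0.
Qed.

Lemma run_ge0 k w i : 0 <= x k w i 0.
Proof. by have [] := run_feasible k w. Qed.

Lemma gap_ge0 k w : 0 <= gap k w.
Proof. by rewrite /gap dotpB subr_ge0; exact: (proj2 hopt) (run_feasible k w). Qed.

Lemma gap_start w : gap 0 w = g0.
Proof. by rewrite /gap (run_start hrun). Qed.

Lemma gap_le k w d' : block_feasible (x k w) [set: 'I_(n * n)]%SET d' ->
  - gap k w <= dotp (vec C) d'.
Proof.
move=> [xd0 Ad _]; rewrite /gap dotpB opprB lerBlDl -dotpD.
apply: (proj2 hopt); split=> //.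
by rewrite mulmxDr Ad addr0; have [] := run_feasible k w.
Qed.

Lemma gap_step k w : gap k.+1 w = gap k w + dotp (vec C) (d k w).
Proof. by rewrite /gap (run_step hrun) !dotpB dotpD addrAC. Qed.

(** The direction from [x k w] to [xstar] attains the lower bound of [gap_le]. *)
Lemma valueT k w : value k w [set: 'I_(n * n)]%SET = - gap k w.
Proof.
apply/eqP; rewrite eq_le; apply/andP; split; last first.
  by apply: block_value_ge; [exact: run_ge0|exact: gap_le].
rewrite /gap -[leRHS](_ : dotp (vec C) (xstar - x k w) = _); last first.
  by rewrite !dotpB opprB.
apply: (block_value_le (@gap_le k w)).
have [[Ax x0] _] := hopt; have [Axk _] := run_feasible k w.
split=> [i|| i]; last by rewrite inE.
  by rewrite addrC subrK.
by rewrite mulmxBr Ax Axk subrr.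
Qed.

Lemma value_block k w : value k w (I k w) = gap k.+1 w - gap k w.
Proof.
rewrite gap_step addrC addKr.
apply: (block_value_optimal (run_ge0 k w) (@gap_le k w)).
exact: (run_direction hrun).
Qed.

Lemma value_le0 k w J : value k w J <= 0.
Proof. exact: (block_value_le0 (run_ge0 k w) (@gap_le k w)). Qed.

Lemma gap_noninc k w : gap k.+1 w <= gap k w.
Proof. by rewrite -subr_le0 -value_block value_le0. Qed.

Lemma gap_le0 k w : gap k w <= g0.
Proof.
rewrite -(gap_start w); elim: k => // k; exact: le_trans (gap_noninc k w).
Qed.

Lemma gap_lb k w d' : block_feasible (x k w) [set: 'I_(n * n)]%SET d' ->
  - g0 <= dotp (vec C) d'.
Proof. by move=> /gap_le; apply: le_trans; rewrite lerN2 gap_le0. Qed.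

Lemma value_norm k w J : `|value k w J| <= g0.
Proof.
rewrite ler0_norm ?value_le0// lerNl.
exact: (block_value_lb (run_ge0 k w) (@gap_lb k w)).
Qed.

(** The submatrix part of the law contributes a nonpositive amount and is dropped; the band part has
    weight [s]. *)
Lemma expected_value_le k w :
  expected_value k w <=
  s * ((n%:R * (p%:R - 2)) / ((n%:R ^+ 2 - 3) * n`!%:R ^+ 2)) *
    value k w [set: 'I_(n * n)]%SET.
Proof.
have [s0 s1] := andP hs.
rewrite /expected_value (eq_bigr (fun J => s * (band_law R p J * value k w J) +
    (1 - s) * (submx_law R m J * value k w J))); last first.
  by move=> J _; rewrite /law /block_law mulrDl -!mulrA.
rewrite big_split/= -!mulr_sumr -[leRHS]addr0 lerD//.
  by rewrite -mulrA ler_wpM2l//; exact: (band_average (run_ge0 k w) (@gap_le k w) hp).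
rewrite mulr_ge0_le0 ?subr_ge0// sumr_le0// => J _.
by rewrite mulr_ge0_le0 ?value_le0//; exact: uniform_law_ge0.
Qed.

(** * Measurability with respect to the history, and the conditional expectation *)

Let G k := iterate_events x k.
Let hist k : measurableType _ := g_sigma_algebraType (G k).

Lemma iterate_measurable k : G k `<=` measurable.
Proof.
move=> _ [j [i [B [_ mB ->]]]]; rewrite -[X in measurable X]setTI.
exact: (run_measurable_iterate hrun).
Qed.

Lemma history_measurable k : <<s G k >> `<=` measurable.
Proof.
exact: smallest_sub (sigma_algebra_measurable T) (@iterate_measurable k).
Qed.

Lemma measurable_fun_hist d' (U : measurableType d') k (f : hist k -> U) :
  measurable_fun setT f -> measurable_fun setT (f : T -> U).
Proof. exact: measurable_fun_sub (@iterate_measurable k) _ _ f. Qed.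

Lemma measurable_iterate_hist k j i : (j <= k)%N ->
  measurable_fun setT (fun w : hist k => x j w i 0).
Proof.
move=> jk _ B mB; rewrite setTI; apply: sub_sigma_algebra.
by exists j, i, B.
Qed.

Lemma measurable_value_hist k J : measurable_fun setT (fun w : hist k => value k w J).
Proof.
apply: (@measurable_block_value _ (hist k) _ _ _ _ g0).
- by move=> i; exact: measurable_iterate_hist.
- exact: run_ge0.
- exact: gap_lb.
Qed.

Lemma measurable_expected_hist k :
  measurable_fun setT (fun w : hist k => expected_value k w).
Proof.
apply: measurable_sum => J.
by apply: measurable_funM; [exact: measurable_cst|exact: measurable_value_hist].
Qed.

Lemma measurable_value k J : measurable_fun setT (fun w => value k w J).
Proof. exact: (measurable_fun_hist (@measurable_value_hist k J)). Qed.

Lemma measurable_expected k : measurable_fun setT (expected_value k).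
Proof. exact: (measurable_fun_hist (@measurable_expected_hist k)). Qed.

Lemma measurable_gap k : measurable_fun setT (gap k).
Proof.
have -> : gap k = \- (value k ^~ [set: 'I_(n * n)]%SET).
  by apply/funext => w /=; rewrite valueT opprK.
exact: measurable_funN (measurable_value k _).
Qed.

Lemma gap_norm k w : `|gap k w| <= g0.
Proof. by rewrite ger0_norm ?gap_ge0// gap_le0. Qed.

Lemma measurable_block_step k : measurable_fun setT (fun w => value k w (I k w)).
Proof.
rewrite (funext (value_block k)).
by apply: measurable_funB; exact: measurable_gap.
Qed.

Lemma past_history k B : <<s G k >> B -> past x I k B.
Proof. by apply: sub_sigma_algebra2 => A GA; left. Qed.

(** [A] is split by the block drawn. Where this is [J], the integrand is [value k w J], a function
    of the history, and independence of the draw turns the restriction to that event into the factor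
    [law J]. *)
Lemma integral_block k A : <<s G k >> A ->
  (\int[P]_(w in A) (value k w (I k w))%:E =
   \int[P]_(w in A) (expected_value k w)%:E)%E.
Proof.
move=> GA.
have mA : measurable A := history_measurable GA.
pose u J w : \bar R := (- value k w J)%:E.
have u0 J w : (0 <= u J w)%E by rewrite lee_fin oppr_ge0 value_le0.
have mu J : measurable_fun setT (u J : hist k -> \bar R).
  by apply/measurable_EFinP/measurable_funN; exact: measurable_value_hist.
have muT J : measurable_fun setT (u J).
  exact: (measurable_fun_hist (mu J)).
pose F J := A `&` (I k @^-1` [set J]).
have mF J : measurable (F J).
  by apply: measurableI => //; exact: (run_measurable_block hrun).
have intF J : (\int[P]_(w in F J) u J w = (law J)%:E * \int[P]_(w in A) u J w)%E.
  have lawJ : 0 <= law J by exact: block_law_ge0.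
  apply: (integral_indep (@iterate_measurable k) (c := NngNum lawJ)) => //.
  - exact: (run_measurable_block hrun).
  - by move=> B GB; exact: (run_block hrun) (past_history GB).
  - exact: mu.
(* Both integrands are nonpositive; negating them gives access to integration of nonnegative
   functions. *)
have neg (f : T -> R) : (forall w, f w <= 0) ->
    (\int[P]_(w in A) (f w)%:E = - \int[P]_(w in A) (- f w)%:E)%E.
  move=> f0; rewrite -integral_ge0N => [|w _]; last by rewrite lee_fin oppr_ge0.
  by apply: eq_integral => w _; rewrite -EFinN opprK.
have expected_le0 w : expected_value k w <= 0.
  rewrite /expected_value sumr_le0// => J _.
  by rewrite mulr_ge0_le0 ?value_le0//; exact: block_law_ge0.
rewrite neg => [|w]; last exact: value_le0.
rewrite [RHS]neg//; congr (- _)%E.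
pose blocks := enum {set 'I_(n * n)}.
have AE : A = \big[setU/set0]_(J <- blocks) F J.
  rewrite -bigcup_seq; apply/seteqP; split=> [w Aw|w [J _ []]//].
  by exists (I k w) => //=; rewrite mem_enum.
rewrite {1}AE ge0_integral_bigsetU//; first last.
- by move=> w _; rewrite lee_fin oppr_ge0 value_le0.
- apply: measurable_funTS; apply/measurable_EFinP/measurable_funN.
  exact: measurable_block_step.
- by move=> J1 J2 _ _ [w [[_ /= e1] [_ /= e2]]]; rewrite -e1 -e2.
- exact: enum_uniq.
transitivity (\sum_(J <- blocks) ((law J)%:E * \int[P]_(w in A) u J w))%E.
  apply: eq_bigr => J _; rewrite -intF; apply: eq_integral => w.
  by rewrite inE => -[_ <-].
transitivity (\int[P]_(w in A) \sum_(J <- blocks) ((law J)%:E * u J w))%E.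
  rewrite ge0_integral_sum//.
  - apply: eq_bigr => J _; rewrite ge0_integralZl_EFin//.
      exact: measurable_funTS.
    exact: block_law_ge0.
  - by move=> J; apply: measurable_funeM; exact: measurable_funTS.
  - by move=> J w _; rewrite mule_ge0// lee_fin block_law_ge0.
apply: eq_integral => w _; rewrite /expected_value big_enum/= -sumrN -sumEFin.
by apply: eq_bigr => J _; rewrite -EFinM mulrN.
Qed.

Lemma integrable_value_block k A : measurable A ->
  P.-integrable A (fun w => (value k w (I k w))%:E).
Proof.
move=> mA; apply: (@bounded_integrable _ _ _ _ _ _ g0) => //.
  exact: measurable_block_step.
by move=> w; exact: value_norm.
Qed.

Lemma integrable_gap k A : measurable A -> P.-integrable A (fun w => (gap k w)%:E).
Proof.
move=> mA; apply: (@bounded_integrable _ _ _ _ _ _ g0) => //.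
  exact: measurable_gap.
by move=> w; exact: gap_norm.
Qed.

Lemma integrable_expected k A :
  measurable A -> P.-integrable A (fun w => (expected_value k w)%:E).
Proof.
move=> mA; apply: (@bounded_integrable _ _ _ _ _ _ (\sum_J law J * g0)) => //.
  exact: measurable_expected.
move=> w; rewrite (le_trans (ler_norm_sum _ _ _))// ler_sum// => J _.
have lawJ : 0 <= law J by exact: block_law_ge0.
by rewrite normrM ger0_norm// ler_wpM2l// value_norm.
Qed.

Lemma cond_exp_expected k : is_cond_exp P (history x k)
  (fun w => value k w (I k w)) (expected_value k).
Proof.
split.
- exact: integrable_value_block.
- exact: integrable_expected.
- move=> B mB; rewrite -[X in history _ _ X]setTI.
  exact: (@measurable_expected_hist k).
- by move=> A GA; rewrite integral_block.
Qed.

Variable v : R.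
Hypothesis v_bound : forall k w,
  expected_value k w <= v * value k w [set: 'I_(n * n)]%SET.

(** For any version [Y] of the conditional expectation, the event [A] where [Y] exceeds the bound
    [Z] belongs to the history. So [Y] and [expected_value] have the same integral over [A], at most
    that of [Z]; as [Y - Z] is positive on [A], this event is negligible. *)
Lemma expected_GSq_run : expected_GSq P x I C v.
Proof.
move=> k; split; first by exists (expected_value k); exact: cond_exp_expected.
move=> Y [_ iY mY eY].
pose Z w := v * value k w [set: 'I_(n * n)]%SET.
have mZ : measurable_fun setT (Z : hist k -> R).
  by apply: measurable_funM; [exact: measurable_cst|exact: measurable_value_hist].
have mZT : measurable_fun setT Z by exact: (measurable_fun_hist mZ).
have mY' : measurable_fun setT (Y : hist k -> R).
  by move=> _ B mB; rewrite setTI; exact: mY.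
have mYT : measurable_fun setT Y by exact: (measurable_fun_hist mY').
pose A := [set w | Z w < Y w].
have GA : <<s G k >> A.
  have /(_ measurableT [set true]) := measurable_fun_ltr mZ mY'.
  by rewrite setTI; apply.
have mA : measurable A := history_measurable GA.
have iZ : P.-integrable A (fun w => (Z w)%:E).
  apply: (@bounded_integrable _ _ _ _ _ _ (`|v| * g0)) => // w.
  by rewrite normrM ler_wpM2l// value_norm.
have iYA : P.-integrable A (fun w => (Y w)%:E) by exact: integrableS iY.
have YZ : (\int[P]_(w in A) `|(Y w - Z w)%:E| = 0)%E.
  apply/eqP; rewrite eq_le integral_ge0 ?andbT//.
  rewrite (eq_integral (fun w => (Y w)%:E - (Z w)%:E)%E); last first.
    move=> w; rewrite inE /A/= => /ltW ZY.
    by rewrite ger0_norm ?subr_ge0// EFinB.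
  rewrite integralB// eY// integral_block// sube_le0.
  by apply: le_integral => //; [exact: integrable_expected|move=> w _; rewrite lee_fin].
move: YZ => /ae_eq_integral_abs; case=> //.
  by apply: measurable_funTS; apply/measurable_EFinP/measurable_funB.
move=> N [mN N0 sN]; exists N; split=> // w /= YZ; apply: sN => /= YA.
apply: YZ; rewrite leNgt; apply/negP => ZY; have [] := YA ZY => /eqP.
by rewrite subr_eq0 gt_eqF.
Qed.

(** * Contraction of the mean gap and convergence *)

Let e k : R := fine (\int[P]_w (gap k w)%:E).

Lemma gap_integralE k : (\int[P]_w (gap k w)%:E = (e k)%:E)%E.
Proof.
by rewrite fineK//; exact: integrable_fin_num (integrable_gap k measurableT).
Qed.

Lemma gap_mean_ge0 k : 0 <= e k.
Proof.
rewrite -lee_fin -gap_integralE integral_ge0// => w _.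
by rewrite lee_fin gap_ge0.
Qed.

(** The increment of the gap is the value of the block drawn. Its mean is that of
    [expected_value k], hence at most [- v * e k]. *)
Lemma gap_mean_step k : e k.+1 <= (1 - v) * e k.
Proof.
rewrite -lee_fin EFinM -!gap_integralE.
have -> : (\int[P]_w (gap k.+1 w)%:E =
    \int[P]_w (gap k w)%:E + \int[P]_w (expected_value k w)%:E)%E.
  rewrite -integral_block; last exact: (@measurableT _ (hist k)).
  rewrite -integralD//.
  - by apply: eq_integral => w _; rewrite value_block -EFinD addrC subrK.
  - exact: integrable_gap.
  - exact: integrable_value_block.
have : (\int[P]_w (expected_value k w)%:E <= (- v)%:E * \int[P]_w (gap k w)%:E)%E.
  rewrite -integralZl//; last exact: integrable_gap.
  apply: le_integral => //.
  - exact: integrable_expected.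
  - by apply: integrableZl => //; exact: integrable_gap.
  - by move=> w _; rewrite lee_fin (le_trans (v_bound k w))// valueT mulrN mulNr.
move=> /(leeD2l (\int[P]_w (gap k w)%:E)%E)/le_trans; apply.
by rewrite gap_integralE -!EFinM -EFinD lee_fin mulrBl mul1r mulNr.
Qed.

Hypothesis v01 : 0 <= v <= 1.

Lemma gap_mean_geometric k : e k <= (1 - v) ^+ k * e 0.
Proof.
have v1 : 0 <= 1 - v by rewrite subr_ge0; case/andP: v01.
elim: k => [|k IH]; first by rewrite expr0 mul1r.
by rewrite (le_trans (gap_mean_step k))// exprS -mulrA ler_wpM2l.
Qed.

Lemma gap_mean_cvg : 0 < v -> e @ \oo --> (0 : R).
Proof.
move=> v0; apply: (@squeeze_cvgr _ _ _ _ (fun=> 0) (fun k => (1 - v) ^+ k * e 0)).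
- by near=> k; rewrite gap_mean_ge0 gap_mean_geometric.
- exact: cvg_cst.
- rewrite -[X in _ --> X](mul0r (e 0)); apply: cvgMl; apply: cvg_expr.
  by have /andP[_ v1] := v01; rewrite ger0_norm ?subr_ge0// ltrBlDr ltrDl.
Unshelve. all: end_near. Qed.

(* The gaps decrease pointwise, and their limit has zero mean. *)
Lemma gap_ae_cvg : 0 < v -> {ae P, forall w, (fun k => gap k w) @ \oo --> (0 : R)}.
Proof.
move=> v0; pose h w := inf (range (gap ^~ w)).
have cvgh w : gap ^~ w @ \oo --> h w.
  apply: nonincreasing_cvgn.
    by apply/nonincreasing_seqP => k; exact: gap_noninc.
  by exists 0 => _ [k _ <-]; exact: gap_ge0.
have hle k w : h w <= gap k w.
  by apply: ge_inf; [exists 0 => _ [l _ <-]; exact: gap_ge0|exists k].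
have h0 w : 0 <= h w.
  by apply: lb_le_inf; [exists (gap 0 w), 0%N|move=> _ [l _ <-]; exact: gap_ge0].
have mh : measurable_fun setT h.
  exact: (@measurable_fun_cvg _ _ _ _ gap _ measurable_gap).
have mhE : measurable_fun setT (EFin \o h) by exact/measurable_EFinP.
have : (\int[P]_w `|(h w)%:E| = 0)%E.
  under eq_integral do rewrite gee0_abs ?lee_fin//.
  apply/eqP; rewrite eq_le integral_ge0 ?andbT; last by move=> w _; rewrite lee_fin.
  (* The mean of [h] is at most each [e k], and these tend to 0. *)
  apply/lee_addgt0Pr => eps eps0; rewrite add0e.
  have /cvgrPdist_le/(_ _ eps0)[k _ /(_ _ (leqnn k))] := gap_mean_cvg v0.
  rewrite /= sub0r normrN ger0_norm ?gap_mean_ge0// -lee_fin -gap_integralE.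
  apply: le_trans; apply: ge0_le_integral => //.
  - by move=> w _; rewrite lee_fin.
  - by apply/measurable_EFinP; exact: measurable_gap.
  - by move=> w _; rewrite lee_fin.
move=> /(ae_eq_integral_abs _ measurableT mhE)[N [mN N0 sN]].
exists N; split=> // w /= gw; apply: sN => /= /(_ Logic.I)[h0w].
by apply: gw; rewrite -h0w; exact: cvgh.
Qed.

End Run.

(** The quotient is at most 1 because [n (p - 2) <= n (n - 2) <= n^2 - 3] and the factorial is at
    least 1. *)
Lemma rate_bounds (R : realType) n p (s : R) : (3 <= p <= n)%N -> 0 <= s <= 1 ->
  let v := s * (n%:R * (p%:R - 2) / ((n%:R ^+ 2 - 3) * n`!%:R ^+ 2)) in
  0 <= v <= 1 /\ (0 < s -> 0 < v).
Proof.
move=> /andP[p3 pn] /andP[s0 s1] v.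
have n3' : 3 <= n%:R :> R by rewrite ler_nat (leq_trans p3).
have p3' : 3 <= p%:R :> R by rewrite ler_nat.
have pn' : p%:R <= n%:R :> R by rewrite ler_nat.
have f1 : 1 <= n`!%:R :> R by rewrite ler1n fact_gt0.
rewrite {}/v; move: n`!%:R n%:R p%:R f1 n3' p3' pn' => f a b f1 a3 b3 ba.
have f2 : 1 <= f ^+ 2 by rewrite exprn_ege1.
have a23 : 0 < a ^+ 2 - 3 by nra.
have den : 0 < (a ^+ 2 - 3) * f ^+ 2 by rewrite mulr_gt0// (lt_le_trans _ f2).
have num : 0 < a * (b - 2) by nra.
have quo0 : 0 < a * (b - 2) / ((a ^+ 2 - 3) * f ^+ 2) by exact: divr_gt0.
have quo1 : a * (b - 2) / ((a ^+ 2 - 3) * f ^+ 2) <= 1.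
  rewrite ler_pdivrMr// mul1r (@le_trans _ _ (a ^+ 2 - 3))//; first by nra.
  by rewrite ler_peMr// ltW.
split; last by move=> s_gt0; exact: mulr_gt0.
by rewrite mulr_ge0 ?(ltW quo0)//= mulr_ile1// ltW.
Qed.

Theorem theorem6 (disp : measure_display) (T : measurableType disp)
    (R : realType) (P : probability T R) (n m p : nat) (s : R)
    (C X0 : 'M[R]_n) (r1 r2 : 'cV[R]_n)
    (x d : nat -> T -> 'cV[R]_(n * n)) (I : nat -> T -> {set 'I_(n * n)})
    (hr1 : forall i, 0 <= r1 i 0) (hr2 : forall i, 0 <= r2 i 0)
    (hopt : exists z, ot_optimal C r1 r2 z)
    (hm : (m < n)%N) (hp : (3 <= p <= n)%N) (hs : 0 <= s <= 1)
    (hX0 : ot_feasible r1 r2 (vec X0))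
    (hrun : rbcd_run P x d I C m p s X0) :
  exists v : R,
    [/\ 0 <= v <= 1,
        0 < s -> 0 < v,
        s * (n%:R * (p%:R - 2)) / ((n%:R ^+ 2 - 3) * n`!%:R ^+ 2) <= v,
        expected_GSq P x I C v
      & forall xstar, ot_optimal C r1 r2 xstar ->
          (forall k, ('E_P[fun w => dotp (vec C) (x k w - xstar)] <=
             ((1 - v) ^+ k)%:E *
               'E_P[fun w => dotp (vec C) (x 0%N w - xstar)])%E) /\
          (0 < s ->
             {ae P, forall w,
                (fun k => dotp (vec C) (x k w - xstar)) @ \oo --> (0 : R)} /\
             ((fun k => 'E_P[fun w => dotp (vec C) (x k w - xstar)]%E) @ \oo
                --> 0%E))].
Proof.
(* The witness is the claimed lower bound itself. *)
pose v := s * (n%:R * (p%:R - 2) / ((n%:R ^+ 2 - 3) * n`!%:R ^+ 2)).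
have [v01 v_gt0] : 0 <= v <= 1 /\ (0 < s -> 0 < v) by exact: rate_bounds.
have bound z (hz : ot_optimal C r1 r2 z) := expected_value_le hp hs hX0 hrun hz.
exists v; split => //.
- by rewrite -mulrA.
- by have [z hz] := hopt; exact: (expected_GSq_run hs hX0 hrun hz (bound z hz)).
move=> z hz.
(* The expectations are finite, which reduces the claims in extended reals to the real means of the
   gap. *)
have meanE k : ('E_P[fun w => dotp (vec C) (x k w - z)] =
    (fine (\int[P]_w (dotp (vec C) (x k w - z))%:E))%:E)%E.
  by rewrite unlock (gap_integralE hX0 hrun hz).
split=> [k|s_gt0].
  rewrite !meanE -EFinM lee_fin.
  exact: (gap_mean_geometric hs hX0 hrun hz (bound z hz) v01).
split; first exact: (gap_ae_cvg hs hX0 hrun hz (bound z hz) v01 (v_gt0 s_gt0)).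
under eq_fun do rewrite meanE.
apply: cvg_EFin; first by near=> k.
exact: (gap_mean_cvg hs hX0 hrun hz (bound z hz) v01 (v_gt0 s_gt0)).
Unshelve. all: end_near. Qed.
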